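(* Let $n,d\ge 1$ be integers. Fix an integer $k_0$ with $1\le k_0\le n$, set $$G=\{x_\alpha\mid\alpha\in\Phi\}\cup\{H_k\mid k\in\{1,\dots,n\}\setminus\{k_0\}\},$$ and fix some (total) ordering of this set. Then the set of all monomials in $G$, with the factors written in the specified order, of total degree at most $d$ is a basis over $\mathbb{Q}$ of the Schur algebra $S(n,d)$.
   Context: The Schur algebra is $S(n,d)=\operatorname{End}_{\Sigma_d}(V^{\otimes d})$, where $V=\mathbb{Q}^n$ and the symmetric group $\Sigma_d$ acts on $V^{\otimes d}$ by permuting the tensor places. The enveloping algebra $U=U(\mathfrak{gl}_n)$ over $\mathbb{Q}$ acts on $V^{\otimes d}$ (a matrix $X\in\mathfrak{gl}_n$ acts as $\sum_{r=1}^d 1^{\otimes(r-1)}\otimes X\otimes 1^{\otimes(d-r)}$), which gives a surjective algebra homomorphism $U\to S(n,d)$; elements of $U$ are identified with their images in $S(n,d)$. $\Phi=\{\varepsilon_i-\varepsilon_j\mid 1\le i\ne j\le n\}$, where $\{\varepsilon_i\}$ is the standard basis of $\mathbb{Z}^n$. For $\alpha=\varepsilon_i-\varepsilon_j\in\Phi$, $x_\alpha$ is the corresponding root vector of $\mathfrak{gl}_n$, i.e. the matrix unit $E_{ij}$, and $H_k$ is the diagonal matrix unit $E_{kk}$. *)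

(* Defs.v *)
From HB Require Import structures.
From mathcomp Require Import all_boot all_order all_fingroup all_algebra.

Set Implicit Arguments.
Unset Strict Implicit.
Unset Printing Implicit Defensive.

Import GRing.Theory.
Local Open Scope ring_scope.

(* V^{⊗d} for V = ℚ^n, in coordinates: [f t] is the coefficient of f on
   e_{t 0} ⊗ ... ⊗ e_{t (d-1)}.  The regular module [rat^o] gives the vectType
   structure. *)
Notation tensor_space n d := {ffun {ffun 'I_d -> 'I_n} -> rat^o}.

Section TensorPower.
Variables n d : nat.
Local Notation T := (tensor_space n d).

Definition pure_tensor (v : 'I_d -> 'cV[rat]_n) : T :=
  [ffun t : {ffun 'I_d -> 'I_n} => \prod_r v r (t r) 0].

(* A_0 ⊗ ... ⊗ A_{d-1}; characterised by [tensor_op_pure] below. *)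
Definition tensor_op_fun (A : 'I_d -> 'M[rat]_n) (f : T) : T :=
  [ffun t : {ffun 'I_d -> 'I_n} =>
    \sum_(u : {ffun 'I_d -> 'I_n}) (\prod_r A r (t r) (u r)) * f u].

Fact tensor_op_is_linear A : linear (tensor_op_fun A).
Proof.
move=> a f g; apply/ffunP => t; rewrite !ffunE /= scaler_sumr -big_split /=.
apply: eq_bigr => u _; rewrite !ffunE mulrDr; congr (_ + _).
exact: (@mulrCA rat).
Qed.

HB.instance Definition _ A :=
  GRing.isLinear.Build rat T T *:%R (tensor_op_fun A) (tensor_op_is_linear A).

Definition tensor_op (A : 'I_d -> 'M[rat]_n) : 'End(T) :=
  linfun (tensor_op_fun A).

Lemma tensor_op_pure A v :
  tensor_op A (pure_tensor v) = pure_tensor (fun r => A r *m v r).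
Proof.
rewrite lfunE; apply/ffunP => t; rewrite !ffunE.
under [RHS]eq_bigr => r _ do rewrite mxE.
rewrite bigA_distr_bigA; apply: eq_bigr => u _.
by rewrite ffunE big_split.
Qed.

(* s permutes the tensor places, moving the factor in place r to place s r;
   see [place_perm_pure]. *)
Definition place_perm_fun (s : 'S_d) (f : T) : T :=
  [ffun t : {ffun 'I_d -> 'I_n} => f [ffun r => t (s r)]].

Fact place_perm_is_linear s : linear (place_perm_fun s).
Proof. by move=> a f g; apply/ffunP => t; rewrite !ffunE. Qed.

HB.instance Definition _ s :=
  GRing.isLinear.Build rat T T *:%R (place_perm_fun s) (place_perm_is_linear s).

Definition place_perm (s : 'S_d) : 'End(T) := linfun (place_perm_fun s).

Lemma place_perm_pure s v :
  place_perm s (pure_tensor v) = pure_tensor (fun r => v ((s^-1)%g r)).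
Proof.
rewrite lfunE; apply/ffunP => t; rewrite !ffunE.
rewrite [RHS](reindex_inj (@perm_inj _ s)) /=.
by apply: eq_bigr => r _; rewrite ffunE permK.
Qed.

Definition place_comm_fun (s : 'S_d) (f : 'End(T)) : 'End(T) :=
  (place_perm s \o f)%VF - (f \o place_perm s)%VF.

Fact place_comm_is_linear s : linear (place_comm_fun s).
Proof.
move=> a f g; rewrite /place_comm_fun comp_lfunDl comp_lfunDr.
by rewrite -comp_lfunZl -comp_lfunZr scalerBr opprD addrACA.
Qed.

HB.instance Definition _ s :=
  GRing.isLinear.Build rat 'End(T) 'End(T) *:%R (place_comm_fun s)
    (place_comm_is_linear s).

(* S(n, d), as a subspace of End(V^{⊗d}); [memv_schur_algebra] below says that
   it consists of the endomorphisms commuting with all place permutations. *)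
Definition schur_algebra : {vspace 'End(T)} :=
  (\bigcap_(s : 'S_d) lker (linfun (place_comm_fun s)))%VS.

Lemma memv_schur_algebra f :
  f \in schur_algebra <->
  forall s : 'S_d, (place_perm s \o f = f \o place_perm s)%VF.
Proof.
rewrite memvE; split=> [/subv_bigcapP fS s | fS].
  by have := fS s isT; rewrite -memvE memv_ker lfunE subr_eq0 => /eqP.
apply/subv_bigcapP => s _.
by rewrite -memvE memv_ker lfunE /= /place_comm_fun fS subrr.
Qed.

(* The image in End(V^{⊗d}) of X in gl_n:
   the sum over r of 1^{⊗(r-1)} ⊗ X ⊗ 1^{⊗(d-r)}. *)
Definition gl_act (X : 'M[rat]_n) : 'End(T) :=
  \sum_(r < d) tensor_op (fun q => if q == r then X else 1%:M).

(* The image in End(V^{⊗d}) of the monomial X_0^{e 0} X_1^{e 1} ... of U(gl_n),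
   where Xs = [:: X_0; X_1; ...]; the bound on the exponents e i is the one of
   [exponents] below.  Composition [\o] is used rather than the ring
   structure on 'End(_), whose product is reversed composition. *)
Definition monomial (Xs : seq 'M[rat]_n)
    (e : {ffun 'I_(size Xs) -> 'I_d.+1}) : 'End(T) :=
  \big[@comp_lfun _ _ _ _ / \1%VF]_(i < size Xs)
    iter (e i) (comp_lfun (gl_act Xs`_i)) \1%VF.

End TensorPower.

(* The pair (i, j) stands for the root ε_i - ε_j. *)
Definition root_system (n : nat) : {set 'I_n * 'I_n} := [set a | a.1 != a.2].

Definition root_vector (n : nat) (a : 'I_n * 'I_n) : 'M[rat]_n :=
  delta_mx a.1 a.2.

Definition diag_unit (n : nat) (k : 'I_n) : 'M[rat]_n := delta_mx k k.

Definition generators (n : nat) (k0 : 'I_n) : seq 'M[rat]_n :=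
  [seq root_vector a | a in root_system n] ++ [seq diag_unit k | k : 'I_n in predC1 k0].

(* Exponent vectors of total degree at most d in N variables.  Each exponent is
   then at most d, so the codomain 'I_d.+1 is no restriction. *)
Definition exponents (N d : nat) : {set {ffun 'I_N -> 'I_d.+1}} :=
  [set e : {ffun 'I_N -> 'I_d.+1} | (\sum_(i < N) e i <= d)%N].

(* Main.v *)
(* Write X_1, ..., X_N for the elements of G.  Together with 1 they form a basis
   of gl_n; let C_0 (dual to 1), C_1, ..., C_N be the dual basis for the pairing
   <C, A> = tr(C^T A).  For a : {places} -> {0, ..., N}, the functional
     Phi_a = C_{a 0} (x) ... (x) C_{a (d-1)}
   takes on a product of m operators X_i the value
     sum over p : {1..m} -> {places} of
       prod_r <C_{a r}, product of the X_i with p_i = r>,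
   and if m <= #{r | a r <> 0} only the p putting the letter X_{a r} alone at
   each place r with a r <> 0, and nothing elsewhere, contribute, each 1.
   For an exponent e of degree at most d let a_e take each value i <> 0 exactly
   e_i times.  For deg e' <= deg e, the value of Phi_{a_e} at the monomial e' is
   then nonzero iff e' = e, so the monomials are linearly independent.
   Conversely the Phi_a separate the endomorphisms, and on S(n, d) Phi_a only
   depends on the multiplicities of the values of a, so the Phi_{a_e} separate
   S(n, d), whose dimension is thus at most the number of monomials. *)

Require Import Defs.
From HB Require Import structures.
From mathcomp Require Import all_boot all_order all_fingroup all_algebra.

Set Implicit Arguments.
Unset Strict Implicit.
Unset Printing Implicit Defensive.

Import GRing.Theory Num.Theory.
Local Open Scope ring_scope.

(** * Linear algebra: independent families and separating functionals *)

Section LinearAlgebra.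
Variables (K : fieldType) (vT : vectType K) (I : finType).

Lemma free_image (A : {set I}) (f : I -> vT) :
  (forall c : I -> K, \sum_(i in A) c i *: f i = 0 ->
     forall i, i \in A -> c i = 0) ->
  free [seq f i | i in A].
Proof.
move=> indep.
have sz : size [seq f i | i in A] == #|A| by rewrite size_image.
apply/(@freeP _ _ _ (Tuple sz)) => k sum0 j.
have Aj := enum_valP j.
pose c i := k (enum_rank_in Aj i).
rewrite -[j](enum_valK_in Aj); apply: (indep c) => //.
rewrite big_enum_val -[RHS]sum0; apply: eq_bigr => i _.
rewrite /c enum_valK_in; congr (_ *: _) => /=.
by rewrite (nth_map (enum_default i)) // -cardE.
Qed.

(** Evaluating all the [phi i] at once is a linear map into row vectors of length [#|A|], and its
    kernel meets [U] trivially. *)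
Lemma dim_leq_separating (U : {vspace vT}) (A : {set I})
    (phi : I -> {linear vT -> K^o}) :
  (forall u, u \in U -> (forall i, i \in A -> phi i u = 0) -> u = 0) ->
  (\dim U <= #|A|)%N.
Proof.
move=> sep.
pose h u : 'rV[K]_#|A| := \row_i phi (enum_val i) u.
have h_lin : linear h.
  by move=> a u v; apply/rowP=> i; rewrite !mxE linearP.
pose hM := GRing.isLinear.Build _ _ _ _ h h_lin.
pose hL : {linear _ -> _} := HB.pack h hM.
have <- := limg_ker_dim (linfun hL) U.
have -> : (U :&: lker (linfun hL) = 0)%VS.
  apply/eqP; rewrite -subv0; apply/subvP => u.
  rewrite memv_cap memv_ker lfunE memv0 => /andP[Uu /eqP hu0].
  apply/eqP/sep => // i Ai; have /rowP/(_ (enum_rank_in Ai i)) := hu0.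
  by rewrite !mxE enum_rankK_in.
rewrite dimv0; apply: leq_trans (dimvS (subvf _)) _.
by rewrite dimvf /dim /= mul1n.
Qed.

End LinearAlgebra.

(** * Tensor products of matrices, place permutations and products of [gl_act] *)

Section TensorOperators.
Variables n d : nat.
Local Notation T := (tensor_space n d).

HB.instance Definition _ := Monoid.isLaw.Build 'End(T) \1%VF
  (@comp_lfun _ _ _ _) (@comp_lfunA _ _ _ _ _)
  (@comp_lfun1l _ _ _) (@comp_lfun1r _ _ _).

HB.instance Definition _ := Monoid.isMulLaw.Build 'End(T) 0
  (@comp_lfun _ _ _ _) (@comp_lfun0l _ _ _ _) (@comp_lfun0r _ _ _ _).

(* Not a canonical instance: the key [+%R] is taken by the ring product. *)
Definition comp_lfun_add : Monoid.add_law 0 (@comp_lfun rat T T T).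
Proof.
pose D := Monoid.isAddLaw.Build 'End(T) (@comp_lfun _ _ _ _) +%R
  (fun f g h => comp_lfunDl f g h) (fun f g h => comp_lfunDr f g h).
exact: (HB.pack (@GRing.add 'End(T)) D).
Defined.

Lemma eq_tensor_op (A B : 'I_d -> 'M[rat]_n) :
  A =1 B -> tensor_op A = tensor_op B.
Proof.
move=> eqAB; apply/lfunP => f; rewrite !lfunE; apply/ffunP => t; rewrite !ffunE.
apply: eq_bigr => u _; congr (_ * _).
by apply: eq_bigr => r _; rewrite eqAB.
Qed.

Lemma tensor_op1 : tensor_op (fun _ : 'I_d => 1%:M : 'M[rat]_n) = \1%VF.
Proof.
apply/lfunP => f; rewrite !lfunE; apply/ffunP => t; rewrite !ffunE.
rewrite (bigD1 t) //= big1 ?mul1r => [|r _]; last by rewrite mxE eqxx.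
rewrite big1 ?addr0 // => u neq_ut.
have [r neq_r] : exists r, t r != u r.
  apply/existsP; rewrite -negb_forall; apply: contra neq_ut => /forallP eq_tu.
  by apply/eqP/ffunP => r; rewrite (eqP (eq_tu r)).
by rewrite (bigD1 r) //= mxE (negPf neq_r) mul0r mul0r.
Qed.

Lemma tensor_op_comp (A B : 'I_d -> 'M[rat]_n) :
  (tensor_op A \o tensor_op B)%VF = tensor_op (fun r => A r *m B r).
Proof.
apply/lfunP => f; rewrite !lfunE /= !lfunE /=; apply/ffunP => t; rewrite !ffunE.
under eq_bigr => u _ do rewrite ffunE mulr_sumr.
rewrite exchange_big /=; apply: eq_bigr => v _.
under [X in _ = X * _]eq_bigr => r _ do rewrite mxE.
rewrite bigA_distr_bigA mulr_suml; apply: eq_bigr => u _.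
by rewrite big_split mulrA.
Qed.

Lemma tensor_op_prod (J : Type) (s : seq J) (A : J -> 'I_d -> 'M[rat]_n) :
  \big[@comp_lfun _ _ _ _ / \1%VF]_(j <- s) tensor_op (A j) =
  tensor_op (fun r => \big[mulmx / 1%:M]_(j <- s) A j r).
Proof.
elim: s => [|j s IHs].
  by rewrite big_nil -tensor_op1; apply: eq_tensor_op => r; rewrite big_nil.
rewrite big_cons IHs tensor_op_comp; apply: eq_tensor_op => r.
by rewrite big_cons.
Qed.

Lemma place_perm_tensor_op (s : 'S_d) (A : 'I_d -> 'M[rat]_n) :
  (place_perm n s \o tensor_op A)%VF =
  (tensor_op (fun r => A (s^-1 r)%g) \o place_perm n s)%VF.
Proof.
apply/lfunP => f; rewrite !lfunE /= !lfunE /=.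
apply/ffunP => t; rewrite !ffunE.
pose h (u : {ffun 'I_d -> 'I_n}) : {ffun 'I_d -> 'I_n} := [ffun r => u (s r)].
pose h' (u : {ffun 'I_d -> 'I_n}) : {ffun 'I_d -> 'I_n} :=
  [ffun r => u (s^-1 r)%g].
have hK : cancel h h' by move=> u; apply/ffunP => r; rewrite !ffunE permKV.
rewrite (reindex_inj (can_inj hK)) /=; apply: eq_bigr => u _.
rewrite ffunE; congr (_ * _).
rewrite [RHS](reindex_inj (@perm_inj _ s)) /=; apply: eq_bigr => r _.
by rewrite !ffunE permK.
Qed.

Lemma schur_algebra_comp f g : f \in schur_algebra n d ->
  g \in schur_algebra n d -> (f \o g)%VF \in schur_algebra n d.
Proof.
move=> /memv_schur_algebra Sf /memv_schur_algebra Sg.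
by apply/memv_schur_algebra => s; rewrite comp_lfunA Sf -!comp_lfunA Sg.
Qed.

Lemma schur_algebra1 : \1%VF \in schur_algebra n d.
Proof. by apply/memv_schur_algebra => s; rewrite comp_lfun1l comp_lfun1r. Qed.

(** Conjugation by [s] turns the summand acting at place [r] into the one acting at place [s r], so
    it only permutes the sum. *)
Lemma gl_act_schur_algebra X : gl_act d X \in schur_algebra n d.
Proof.
apply/memv_schur_algebra => s.
have comp_sumr (F : 'I_d -> 'End(T)) g :
    (g \o \sum_r F r)%VF = \sum_r (g \o F r)%VF.
  by apply: (big_morph (comp_lfun g)) => [f1 f2|];
      rewrite (comp_lfunDr, comp_lfun0r).
have comp_suml (F : 'I_d -> 'End(T)) g :
    (\sum_r F r \o g)%VF = \sum_r (F r \o g)%VF.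
  by apply: (big_morph (fun f => comp_lfun f g)) => [f1 f2|];
    rewrite (comp_lfunDl, comp_lfun0l).
rewrite comp_sumr comp_suml [RHS](reindex_inj (@perm_inj _ s)) /=.
apply: eq_bigr => r _; rewrite place_perm_tensor_op; congr (_ \o _)%VF.
by apply: eq_tensor_op => q; rewrite -(inj_eq (@perm_inj _ s)) permKV.
Qed.

(** Distributivity: [p] chooses a place for each letter, and letters sent to the same place multiply
    there in their order. *)
Lemma gl_act_prod (m : nat) (X : 'I_m -> 'M[rat]_n) :
  \big[@comp_lfun _ _ _ _ / \1%VF]_(k < m) gl_act d (X k) =
  \sum_(p : {ffun 'I_m -> 'I_d}) tensor_op
     (fun r => \big[mulmx / 1%:M]_(k < m) if r == p k then X k else 1%:M).
Proof.
rewrite (@bigA_distr_bigA _ 0 \1%VF (@comp_lfun _ T T T) comp_lfun_add) /=.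
by apply: eq_bigr => p _; rewrite tensor_op_prod.
Qed.

End TensorOperators.

(** * Multiplicities of values, and matchings of letters with places *)

Section Fibers.

Lemma perm_of_fibers (J : finType) d (a a' : 'I_d -> J) :
  (forall x, #|[set r | a r == x]| = #|[set r | a' r == x]|) ->
  exists s : 'S_d, forall r, a r = a' (s r).
Proof.
move=> eq_fib.
have count_fib (f : 'I_d -> J) x :
    count_mem x [tuple f r | r < d] = #|[set r | f r == x]|.
  rewrite -sum1_count big_map -sum1dep_card.
  exact: big_enum_cond.
have /tuple_permP[s eq_s] : perm_eq [tuple a r | r < d] [tuple a' r | r < d].
  by apply/allP => x _; rewrite /= !count_fib eq_fib.
exists s => r; rewrite -[LHS](tnth_mktuple a).
by rewrite (val_inj eq_s) !tnth_mktuple.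
Qed.

Variables (I : finType) (d : nat) (a : 'I_d -> option I).

Lemma card_isSome :
  #|[set r | a r]| = (\sum_i #|[set r | a r == Some i]|)%N.
Proof.
under eq_bigr => i _ do rewrite -sum1dep_card big_mkcond.
rewrite exchange_big -sum1dep_card big_mkcond; apply: eq_bigr => r _ /=.
case: (a r) => [j|] /=; last by rewrite big1.
rewrite (bigD1 j) //= eqxx big1 // => i /negPf neq_ij.
by rewrite (inj_eq Some_inj) eq_sym neq_ij.
Qed.

Lemma card_None :
  #|[set r | a r == None]| = (d - \sum_i #|[set r | a r == Some i]|)%N.
Proof.
rewrite -card_isSome; have := cardsC [set r | a r]; rewrite card_ord.
move=> def_d; rewrite -[X in (X - _)%N]def_d addKn.
by apply: eq_card => r; rewrite !inE; case: (a r).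
Qed.

(* [p] puts the letters of the word [w] at distinct places, where [a] prescribes
   them, and covers all the places where [a] prescribes a letter. *)
Definition matching m (w : 'I_m -> I) (p : {ffun 'I_m -> 'I_d}) : bool :=
  [&& injectiveb p, [forall k, a (p k) == Some (w k)]
    & [forall r, a r ==> (r \in codom p)]].

Lemma matchingP m (w : 'I_m -> I) (p : {ffun 'I_m -> 'I_d}) :
  reflect [/\ injective p, forall k, a (p k) = Some (w k)
            & forall r, a r -> r \in codom p]
          (matching w p).
Proof.
apply: (iffP and3P).
  move=> [/injectiveP ? /forallP eq_a /forallP cov].
  by split=> // [k|r]; [apply/eqP | apply/implyP].
move=> [? eq_a cov].
by split; [apply/injectiveP | apply/forallP=> k; apply/eqP
          | apply/forallP=> r; apply/implyP/cov].
Qed.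

(** A matching restricts to a bijection from the occurrences of [i] in [w] onto the places where [a]
    prescribes [i]. *)
Lemma matching_fibers m (w : 'I_m -> I) (p : {ffun 'I_m -> 'I_d}) i :
  matching w p -> #|[set r | a r == Some i]| = #|[set k | w k == i]|.
Proof.
case/matchingP=> p_inj eq_a cov; rewrite -(card_imset _ p_inj).
apply: eq_card => r; rewrite inE; apply/eqP/imsetP => [ar | [k + ->]].
  have /codomP[k def_r] : r \in codom p by apply: cov; rewrite ar.
  by exists k; rewrite // inE; apply/eqP/Some_inj; rewrite -eq_a -def_r.
by rewrite inE eq_a => /eqP ->.
Qed.

End Fibers.

HB.instance Definition _ (R : pzSemiRingType) n :=
  Monoid.isLaw.Build 'M[R]_n 1%:M mulmx
    (@mulmxA R n n n n) (@mul1mx R n n) (@mulmx1 R n n).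

(** * Functionals on endomorphisms of the tensor space *)

Section TensorFunctionals.
Variables n d : nat.
Local Notation T := (tensor_space n d).
Local Notation index := {ffun 'I_d -> 'I_n}.

Definition lfun_coef (g : 'End(T)) (t u : index) : rat :=
  g [ffun v => (v == u)%:R] t.

Lemma tensor_coef (g : 'End(T)) f t : g f t = \sum_u f u * lfun_coef g t u.
Proof.
have {1}-> : f = \sum_u f u *: ([ffun v => (v == u)%:R] : T).
  apply/ffunP => v; rewrite sum_ffunE (bigD1 v) //= big1 => [|u neq_uv].
    by rewrite addr0 !ffunE eqxx [RHS]mulr1.
  by rewrite !ffunE eq_sym (negPf neq_uv) [LHS]mulr0.
rewrite linear_sum sum_ffunE; apply: eq_bigr => u _.
by rewrite linearZ ffunE.
Qed.

Lemma lfun_coef_tensor_op A t u :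
  lfun_coef (tensor_op A) t u = \prod_r A r (t r) (u r).
Proof.
rewrite /lfun_coef lfunE /= ffunE (bigD1 u) //= [X in _ + X]big1 => [|v neq_vu].
  by rewrite ffunE eqxx mulr1 addr0.
by rewrite ffunE (negPf neq_vu) mulr0.
Qed.

(** [place_perm s] carries the basis vector at [u] composed with [s] to the one at [u], so commuting
    with it makes the matrix coefficients invariant. *)
Lemma lfun_coef_schur_algebra g (s : 'S_d) (t u : index) :
  g \in schur_algebra n d ->
  lfun_coef g [ffun r => t (s r)] [ffun r => u (s r)] = lfun_coef g t u.
Proof.
move=> /memv_schur_algebra/(_ s)/lfunP Sg.
have /ffunP/(_ t) := Sg [ffun v => (v == [ffun r => u (s r)])%:R].
rewrite !comp_lfunE !lfunE /= ffunE => E; rewrite [LHS]E /lfun_coef.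
congr (g _ t); apply/ffunP => v; rewrite !ffunE.
congr (_%:R); congr nat_of_bool.
apply/eqP/eqP => [/ffunP eq_vu | -> //].
by apply/ffunP => r; have := eq_vu (s^-1 r)%g; rewrite !ffunE permKV.
Qed.

Definition mx_pair (C A : 'M[rat]_n) : rat := \sum_i \sum_j C i j * A i j.

(** The trace pairing with the tensor product of the [C r], written in matrix coefficients so that
    linearity in [g] is immediate. *)
Definition tensor_functional (C : 'I_d -> 'M[rat]_n) (g : 'End(T)) : rat^o :=
  \sum_(t : index) \sum_(u : index) (\prod_r C r (t r) (u r)) * lfun_coef g t u.

Fact tensor_functional_is_linear C : linear (tensor_functional C).
Proof.
move=> a f g; rewrite /tensor_functional scaler_sumr -big_split /=.
apply: eq_bigr => t _; rewrite scaler_sumr -big_split; apply: eq_bigr => u _ /=.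
rewrite /lfun_coef !lfunE /= !ffunE mulrDr; congr (_ + _).
by rewrite lfunE ffunE [LHS]mulrCA.
Qed.

HB.instance Definition _ C := GRing.isLinear.Build rat 'End(T) rat^o *:%R
  (tensor_functional C) (tensor_functional_is_linear C).

Lemma tensor_functional_op C A :
  tensor_functional C (tensor_op A) = \prod_r mx_pair (C r) (A r).
Proof.
rewrite /mx_pair bigA_distr_bigA; apply: eq_bigr => t _.
rewrite bigA_distr_bigA; apply: eq_bigr => u _.
by rewrite lfun_coef_tensor_op big_split.
Qed.

Lemma tensor_functional_perm C g (s : 'S_d) : g \in schur_algebra n d ->
  tensor_functional (fun r => C (s r)) g = tensor_functional C g.
Proof.
move=> Sg.
pose h (u : index) : index := [ffun r => u (s r)].
pose h' (u : index) : index := [ffun r => u (s^-1 r)%g].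
have hK : cancel h h' by move=> u; apply/ffunP => r; rewrite !ffunE permKV.
rewrite /tensor_functional (reindex_inj (can_inj hK)) /=; apply: eq_bigr => t _.
rewrite (reindex_inj (can_inj hK)) /=; apply: eq_bigr => u _.
rewrite lfun_coef_schur_algebra //; congr (_ * _).
rewrite [RHS](reindex_inj (@perm_inj _ s)) /=; apply: eq_bigr => r _.
by rewrite !ffunE.
Qed.

Variables (I : finType) (X : I -> 'M[rat]_n).
Variable C : option I -> 'M[rat]_n.

Definition with_unit (x : option I) : 'M[rat]_n :=
  if x is Some i then X i else 1%:M.

Hypothesis C_dual : forall x y, mx_pair (C x) (with_unit y) = (x == y)%:R.
(** Completeness of the dual bases: every matrix [A] is the sum over [x] of
    [mx_pair (C x) A *: with_unit x]. *)
Hypothesis C_total : forall i j k l,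
  \sum_x with_unit x i j * C x k l = ((i == k) && (j == l))%:R.

(** Multiplying the completeness relation over all places writes each matrix coefficient of [g] as a
    combination of these functionals. *)
Lemma tensor_functional_eq0 g :
  (forall a : {ffun 'I_d -> option I},
     tensor_functional (fun r => C (a r)) g = 0) -> g = 0.
Proof.
move=> g0.
suff coef0 t u : lfun_coef g t u = 0.
  apply/lfunP => f; rewrite lfunE; apply/ffunP => t.
  by rewrite tensor_coef ffunE big1 // => u _; rewrite coef0 mulr0.
(* The coefficient of the functional of [a] in the expansion of [lfun_coef g t u]. *)
pose b (a : {ffun 'I_d -> option I}) := \prod_r with_unit (a r) (t r) (u r).
have b_dual (t' u' : index) :
    \sum_a b a * \prod_r C (a r) (t' r) (u' r) = ((t == t') && (u == u'))%:R.
  under eq_bigr => a _ do rewrite -big_split /=.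
  rewrite -(bigA_distr_bigA
    (fun r x => with_unit x (t r) (u r) * C x (t' r) (u' r))).
  under eq_bigr => r _ do rewrite C_total.
  have [/andP[/eqP-> /eqP->] | neq] := boolP (_ && _).
    by apply: big1 => r _; rewrite !eqxx.
  suff [r /negPf neq_r] : exists r, ~~ ((t r == t' r) && (u r == u' r)).
    by rewrite (bigD1 r) //= neq_r mul0r.
  apply/existsP; rewrite -negb_forall; apply: contra neq => /forallP eq_tu.
  by apply/andP; split; apply/eqP/ffunP => r;
    have /andP[/eqP ? /eqP ?] := eq_tu r.
have <- : \sum_a b a * tensor_functional (fun r => C (a r)) g = 0.
  by rewrite big1 // => a _; rewrite g0 mulr0.
under eq_bigr => a _.
  rewrite mulr_sumr; under eq_bigr => t' _.
    rewrite mulr_sumr; under eq_bigr => u' _ do rewrite mulrA.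
  over.
over.
rewrite exchange_big /= (bigD1 t) //= [X in _ + X]big1 ?addr0 => [|t' neq_t].
  rewrite exchange_big /= (bigD1 u) //= [X in _ + X]big1 ?addr0 => [|u' neq_u].
    by rewrite -mulr_suml b_dual !eqxx mul1r.
  by rewrite -mulr_suml b_dual [u == _]eq_sym (negPf neq_u) andbF mul0r.
rewrite exchange_big /= big1 // => u' _.
by rewrite -mulr_suml b_dual [t == _]eq_sym (negPf neq_t) mul0r.
Qed.

(* A nonzero value forces each place with [a r <> None] to carry a letter, as
   [C (Some i)] kills the identity; the bound on [m] then leaves no room for a
   product of two letters. *)
Lemma tensor_functional_placement m (w : 'I_m -> I) (a : 'I_d -> option I)
    (p : {ffun 'I_m -> 'I_d}) : (m <= #|[set r | a r]|)%N ->
  tensor_functional (fun r => C (a r)) (tensor_op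
     (fun r => \big[mulmx / 1%:M]_(k < m) if r == p k then X (w k) else 1%:M))
  = (matching a w p)%:R.
Proof.
move=> le_m; rewrite tensor_functional_op.
under eq_bigr => r _ do rewrite -big_mkcond.
have prod_inj k : injective p ->
    \big[mulmx/1%:M]_(k' < m | p k == p k') X (w k') = X (w k).
  move=> p_inj; rewrite (big_pred1 k) // => k'.
  by rewrite (inj_eq p_inj) eq_sym.
have [/matchingP[p_inj eq_a cov] | /negP not_match] := boolP (matching a w p).
  rewrite big1 // => r _; have [/cov/codomP[k ->] | ar] := boolP (isSome (a r)).
    by rewrite prod_inj // (C_dual _ (Some _)) eq_a eqxx.
  rewrite big_pred0 => [|k]; first by rewrite (C_dual _ None); case: (a r) ar.
  by apply: contraNF ar => /eqP ->; rewrite eq_a.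
apply/eqP; apply: contra_notT not_match => /prodf_neq0 nz.
have cov r : a r -> r \in codom p.
  apply: contraTT => r_p; have := nz r isT.
  rewrite big_pred0 => [|k]; last first.
    by apply: contraNF r_p => /eqP ->; apply: codom_f.
  by rewrite (C_dual _ None) pnatr_eq0 eqb0 negbK => /eqP ->.
have sub_p : [set r | a r] \subset codom p.
  by apply/subsetP => r; rewrite inE; apply: cov.
have card_p : #|codom p| = m.
  apply/eqP; rewrite eqn_leq (leq_trans le_m (subset_leq_card sub_p)) andbT.
  by rewrite (leq_trans (leq_image_card _ _)) // card_ord.
have p_inj : injective p.
  have /image_injP p_inj : #|codom p| == #|'I_m| by rewrite card_p card_ord.
  by move=> k k'; apply: p_inj.
(* The places with a prescribed letter number at least [m] and lie in [codom p], which has [m]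
   elements, so the two sets coincide. *)
have p_a k : a (p k).
  have := subset_cardP _ sub_p; rewrite card_p => eq_p.
  have /eq_p/(_ (p k)) : #|[set r | a r]| = m.
    by apply/eqP; rewrite eqn_leq le_m -{1}card_p subset_leq_card.
  by rewrite inE codom_f.
apply/matchingP; split=> // k; have := nz (p k) isT.
by rewrite prod_inj // (C_dual _ (Some _)) pnatr_eq0 eqb0 negbK => /eqP.
Qed.

Lemma tensor_functional_gl_act m (w : 'I_m -> I) (a : 'I_d -> option I) :
  (m <= #|[set r | a r]|)%N ->
  tensor_functional (fun r => C (a r))
    (\big[@comp_lfun _ _ _ _ / \1%VF]_(k < m) gl_act d (X (w k))) =
  #|[set p | matching a w p]|%:R.
Proof.
move=> le_m; rewrite gl_act_prod linear_sum -sum1dep_card natr_sum.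
rewrite [RHS]big_mkcond; apply: eq_bigr => p _ /=.
by rewrite tensor_functional_placement //; case: matching.
Qed.

End TensorFunctionals.

(** * Exponent vectors as words and as labelings of the places *)

Section ExponentWords.
Variables N d : nat.
Implicit Type e : {ffun 'I_N -> 'I_d.+1}.

Definition exponent_word e : seq 'I_N :=
  flatten [seq nseq (e i) i | i <- index_enum 'I_N].

Lemma size_exponent_word e : size (exponent_word e) = (\sum_(i < N) e i)%N.
Proof.
rewrite size_flatten /shape -map_comp sumnE big_map.
by apply: eq_bigr => i _; rewrite /= size_nseq.
Qed.

Lemma exponent_word_fibers e i :
  #|[set k | tnth (in_tuple (exponent_word e)) k == i]| = e i.
Proof.
rewrite -sum1dep_card -(big_tnth _ _ (exponent_word e) (pred1 i) (fun=> 1%N)).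
rewrite big_flatten big_map (bigD1 i) //= big_nseq_cond /= eqxx.
rewrite big1 => [|j /negPf neq_ji]; last by rewrite big_nseq_cond /= neq_ji.
by rewrite addn0 iter_addn_0 mul1n.
Qed.

(** A representative with multiplicities [e]: place [r] gets the [r]-th letter of the word, and
    [None], standing for the identity matrix, past its end. *)
Definition exponent_place e (r : 'I_d) : option 'I_N :=
  nth None (map Some (exponent_word e)) r.

Lemma exponent_place_matching e : e \in exponents N d ->
  exists p, matching (exponent_place e) (tnth (in_tuple (exponent_word e))) p.
Proof.
rewrite inE -size_exponent_word => le_d.
exists [ffun k => widen_ord le_d k]; apply/matchingP; split.
- by move=> k k' /eqP; rewrite !ffunE -val_eqE => /eqP /= /val_inj.
- move=> k; rewrite ffunE /exponent_place /= (nth_map (tnth (in_tuple _) k)) //.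
  by congr Some; apply/esym/tnth_nth.
move=> r a_r; have lt_r : (r < size (exponent_word e))%N.
  by apply: contraLR a_r; rewrite -leqNgt => le_r;
    rewrite /exponent_place nth_default ?size_map.
by apply/codomP; exists (Ordinal lt_r); rewrite ffunE; apply: val_inj.
Qed.

Lemma exponent_place_fibers e i : e \in exponents N d ->
  #|[set r | exponent_place e r == Some i]| = e i.
Proof.
move=> /exponent_place_matching[p /matching_fibers ->].
exact: exponent_word_fibers.
Qed.

Lemma exponent_of_fibers (a : 'I_d -> option 'I_N) :
  exists2 e, e \in exponents N d & forall i, #|[set r | a r == Some i]| = e i.
Proof.
(* [inord] truncates nothing here, since a fiber has at most [d] elements. *)
pose e : {ffun 'I_N -> 'I_d.+1} := [ffun i => inord #|[set r | a r == Some i]|].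
have e_fib i : #|[set r | a r == Some i]| = e i.
  by rewrite ffunE inordK // ltnS -[d in (_ <= d)%N]card_ord max_card.
exists e => //; rewrite inE; under eq_bigr => i _ do rewrite -e_fib.
by rewrite -card_isSome -[d in (_ <= d)%N]card_ord max_card.
Qed.

End ExponentWords.

Lemma monomial_word n d (Xs : seq 'M[rat]_n)
    (e : {ffun 'I_(size Xs) -> 'I_d.+1}) :
  monomial e = \big[@comp_lfun _ _ _ _ / \1%VF]_(k < size (exponent_word e))
    gl_act d Xs`_(tnth (in_tuple (exponent_word e)) k).
Proof.
rewrite -(big_tnth _ _ (exponent_word e) predT (fun i => gl_act d Xs`_i)).
rewrite big_flatten big_map; apply: eq_bigr => i _.
by rewrite big_nseq.
Qed.

(** * The basis of gl_n formed by 1 and the generators, and its dual *)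

Section DualBasis.
Variable n : nat.
Implicit Types A B D : 'M[rat]_n.

Lemma mx_pairBZl c A B D :
  mx_pair (A - c *: B) D = mx_pair A D - c * mx_pair B D.
Proof.
rewrite /mx_pair mulr_sumr -sumrB; apply: eq_bigr => i _.
rewrite mulr_sumr -sumrB; apply: eq_bigr => j _.
by rewrite !mxE mulrBl mulrA.
Qed.

Lemma mx_pair_delta i j A : mx_pair (delta_mx i j) A = A i j.
Proof.
rewrite /mx_pair (bigD1 i) //= (bigD1 j) //= mxE !eqxx mul1r.
rewrite !big1 ?addr0 // => [k /negPf neq_k | k /negPf neq_k].
  by rewrite big1 // => l _; rewrite mxE neq_k mul0r.
by rewrite mxE neq_k andbF mul0r.
Qed.

Lemma mx_pair1 A : mx_pair A 1%:M = \tr A.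
Proof.
apply: eq_bigr => i _; rewrite (bigD1 i) //= mxE eqxx mulr1.
by rewrite big1 ?addr0 // => j /negPf neq_j; rewrite mxE eq_sym neq_j mulr0.
Qed.

Lemma delta_mx_inj (a b : 'I_n * 'I_n) :
  delta_mx a.1 a.2 = delta_mx b.1 b.2 :> 'M[rat]_n -> a = b.
Proof.
case: a b => [i j] [k l] /= /matrixP/(_ i j); rewrite !mxE !eqxx /=.
by case: eqP => [->|] //=; case: eqP => [->|].
Qed.

Variables (k0 : 'I_n) (Xs : seq 'M[rat]_n).
Hypotheses (Xs_uniq : uniq Xs) (Xs_gen : Xs =i generators k0).

Lemma generators_perm :
  perm_eq Xs [seq delta_mx a.1 a.2 | a in predC1 (k0, k0)].
Proof.
apply: uniq_perm => // [|A].
  rewrite map_inj_in_uniq ?enum_uniq // => a b _ _; exact: delta_mx_inj.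
rewrite Xs_gen mem_cat; apply/orP/imageP.
  case=> /imageP[] => [[i j] | k]; rewrite inE /= => neq ->.
    exists (i, j) => //; rewrite inE; apply: contra neq.
    by rewrite xpair_eqE => /andP[/eqP-> /eqP->].
  by exists (k, k) => //; rewrite inE xpair_eqE andbb.
case=> [[i j]]; rewrite inE /= xpair_eqE => neq ->.
have [eq_ij | neq_ij] := eqVneq i j; [right | left]; apply/imageP.
  by exists i; rewrite ?eq_ij // inE; move: neq; rewrite eq_ij andbb.
by exists (i, j); rewrite ?inE.
Qed.

(** The trace correction makes the pairing with 1 vanish; it leaves the pairings with generators
    unchanged, as these have entry 0 at [(k0, k0)]. *)
Definition dual_basis (x : option 'I_(size Xs)) : 'M[rat]_n :=
  if x is Some i then Xs`_i - \tr Xs`_i *: delta_mx k0 k0 else delta_mx k0 k0.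

Lemma dual_basisP x y :
  mx_pair (dual_basis x) (with_unit (fun i : 'I_(size Xs) => Xs`_i) y) =
  (x == y)%:R.
Proof.
have XsE (i : 'I_(size Xs)) :
    exists2 a, a != (k0, k0) & Xs`_i = delta_mx a.1 a.2.
  have: Xs`_i \in Xs by apply: mem_nth.
  by rewrite (perm_mem generators_perm) => /imageP[a]; exists a.
have Xs_k0 (i : 'I_(size Xs)) : Xs`_i k0 k0 = 0.
  have [[j k] neq ->] := XsE i; rewrite mxE.
  by rewrite ![k0 == _]eq_sym -xpair_eqE (negPf neq).
case: x y => [i|] [j|] /=.
- rewrite mx_pairBZl mx_pair_delta Xs_k0 mulr0 subr0.
  have [a _ Xi] := XsE i; rewrite Xi mx_pair_delta.
  have [b _ Xj] := XsE j; rewrite Xj mxE -xpair_eqE -!surjective_pairing.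
  congr (_%:R); congr nat_of_bool; rewrite (inj_eq Some_inj).
  apply/eqP/eqP => [eq_ab | eq_ij]; last first.
    by apply: delta_mx_inj; rewrite -Xi -Xj eq_ij.
  have /eqP : Xs`_i = Xs`_j by rewrite Xi Xj eq_ab.
  by rewrite nth_uniq // => /eqP /val_inj.
- by rewrite mx_pairBZl mx_pair_delta mx_pair1 mxE eqxx mulr1 subrr.
- by rewrite mx_pair_delta Xs_k0.
by rewrite mx_pair_delta mxE eqxx.
Qed.

Lemma dual_basis_total i j k l :
  \sum_x with_unit (fun i : 'I_(size Xs) => Xs`_i) x i j * dual_basis x k l =
  ((i == k) && (j == l))%:R.
Proof.
pose F A := A i j * (A - \tr A *: delta_mx k0 k0) k l.
have sum_Xs : \sum_(m < size Xs) F Xs`_m =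
    \sum_(a | a != (k0, k0)) F (delta_mx a.1 a.2).
  rewrite -[RHS]big_image -(perm_big _ generators_perm).
  by rewrite [RHS](big_nth 0) big_mkord.
have F_delta (a : 'I_n * 'I_n) : a != (i, j) -> F (delta_mx a.1 a.2) = 0.
  rewrite /F mxE => /negPf neq.
  by rewrite -xpair_eqE -surjective_pairing eq_sym neq mul0r.
have tr_delta : \tr (delta_mx i j : 'M[rat]_n) = (i == j)%:R.
  by rewrite -mx_pair1 mx_pair_delta mxE.
rewrite (bigD1 None) //= (reindex_omap Some id) => [|[]] //=.
rewrite (eq_bigl predT) => [|m]; last by rewrite eqxx.
rewrite sum_Xs.
have [[def_i def_j] | neq_ij] := eqVneq (i, j) (k0, k0).
  rewrite big1 => [|a neq_a]; last by rewrite F_delta // def_i def_j.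
  by rewrite def_i def_j !mxE eqxx mul1r addr0 ![k0 == _]eq_sym.
(* Only the generator [delta_mx i j] contributes, and its trace correction cancels the [None]
   term. *)
rewrite (bigD1 (i, j)) //= big1 => [|a /andP[_ neq_a]]; last exact: F_delta.
rewrite /F tr_delta !mxE !eqxx mul1r addr0 addrC subrK.
by rewrite [k == i]eq_sym [l == j]eq_sym.
Qed.

End DualBasis.

(* The sequence Xs is the total ordering of the generating set: it lists every
   generator exactly once, in increasing order. *)
Theorem theorem2 (n d : nat) (n_gt0 : (0 < n)%N) (d_gt0 : (0 < d)%N)
    (k0 : 'I_n) (Xs : seq 'M[rat]_n)
    (Xs_uniq : uniq Xs) (Xs_gen : Xs =i generators k0) :
  basis_of (schur_algebra n d)
    [seq monomial e | e in exponents (size Xs) d].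
Proof.
pose X (i : 'I_(size Xs)) := Xs`_i.
pose C := @dual_basis n k0 Xs.
have C_dual : forall x y, mx_pair (C x) (with_unit X y) = (x == y)%:R.
  exact: dual_basisP.
have C_total : forall i j k l,
    \sum_x with_unit X x i j * C x k l = ((i == k) && (j == l))%:R.
  exact: dual_basis_total.
pose phi (e : {ffun 'I_(size Xs) -> 'I_d.+1}) :
    {linear 'End(tensor_space n d) -> rat^o} :=
  tensor_functional (fun r => C (exponent_place e r)).
rewrite basisEfree; apply/and3P; split.
- apply: free_image => c sum0 e0 e0_in.
  apply/eqP; apply: contraTT isT => c_e0.
  pose degree (e : {ffun 'I_(size Xs) -> 'I_d.+1}) := (\sum_i e i)%N.
  pose P (e : {ffun 'I_(size Xs) -> 'I_d.+1}) :=
    (e \in exponents (size Xs) d) && (c e != 0).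
  have P_e0 : P e0 by rewrite /P e0_in.
  (* Maximal degree among the nonzero coefficients ensures that [phi e] is only evaluated on words
     of length at most the degree of [e]. *)
  case: (arg_maxnP degree P_e0) => e /andP[e_in c_e] e_max.
  have /eqP := congr1 (phi e) sum0; rewrite linear0 linear_sum /=.
  have phiE e' : e' \in exponents (size Xs) d -> c e' != 0 ->
      phi e (monomial e') = #|[set p | matching (exponent_place e)
        (tnth (in_tuple (exponent_word e'))) p]|%:R.
    move=> e'_in c_e'; rewrite monomial_word.
    apply: (tensor_functional_gl_act C_dual).
    rewrite card_isSome size_exponent_word.
    under [leqRHS]eq_bigr => i _ do rewrite exponent_place_fibers //.
    by apply: e_max; rewrite /P e'_in.
  rewrite (bigD1 e) //= big1 => [|e' /andP[e'_in neq_e']].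
    rewrite addr0 linearZ mulf_eq0 (negPf c_e) phiE //= pnatr_eq0 cards_eq0.
    have [p p_e] := exponent_place_matching e_in.
    by move=> /eqP/setP/(_ p); rewrite !inE p_e.
  have [-> | c_e'] := eqVneq (c e') 0; first by rewrite scale0r linear0.
  rewrite linearZ /= phiE //; set ps := finset _.
  have [-> | /set0Pn[p]] := eqVneq ps set0.
    by rewrite cards0 [LHS]mulr0.
  (* A matching would force equal multiplicities, hence [e' = e]. *)
  rewrite inE => p_e'; case/eqP: neq_e'; apply/ffunP => i; apply: val_inj.
  rewrite /= -(exponent_place_fibers i e_in) (matching_fibers i p_e').
  by rewrite exponent_word_fibers.
- apply/span_subvP => _ /imageP[e _ ->]; rewrite monomial_word.
  elim/big_rec: _ => [|k f _ Sf]; first exact: schur_algebra1.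
  by apply: schur_algebra_comp => //; apply: gl_act_schur_algebra.
(* It remains to bound the dimension: the [phi e] must separate the Schur algebra. *)
rewrite size_image; apply: (@dim_leq_separating _ _ _ _ _ phi) => g Sg phi_g.
apply: (tensor_functional_eq0 C_total) => a.
have [e e_in a_fib] := exponent_of_fibers a.
have [|s a_s] := @perm_of_fibers _ d a (exponent_place e).
  case=> [i|]; first by rewrite exponent_place_fibers.
  (* The [None] fibers agree too, being complements in the [d] places. *)
  rewrite !card_None; congr (_ - _)%N; apply: eq_bigr => i _.
  by rewrite exponent_place_fibers.
rewrite -[RHS](phi_g e e_in) /phi /=.
rewrite -(tensor_functional_perm (fun r => C (exponent_place e r)) s Sg).
apply: eq_bigr => t _; apply: eq_bigr => u _; congr (_ * _).
by apply: eq_bigr => r _; rewrite a_s.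
Qed.
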